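(* There exists a homeomorphism $T\colon X\to X$ of a Cantor set $X$ which is transitive, not minimal, and has no periodic points, and which is conjugate to a homeomorphism $f\colon K\to K$ of a Cantor set $K\subseteq\mathbb{R}$ satisfying $f'(x)=0$ for every $x\in K$.
   Context: A Cantor set is a compact metric space that is totally disconnected and has no isolated points. $(X,T)$ is minimal if $X$ has no nonempty proper closed subset $A$ with $T(A)=A$; transitive if for all nonempty open $U,V\subseteq X$ there is $n\in\mathbb{N}$ with $T^n(U)\cap V\neq\emptyset$. A periodic point is $x$ with $T^n(x)=x$ for some $n\geq1$. Conjugacy means there is a homeomorphism $h\colon X\to K$ with $h\circ T=f\circ h$. For $K\subseteq\mathbb{R}$ perfect, $f'(x)=\lim_{y\to x,\,y\in K\setminus\{x\}}\frac{f(y)-f(x)}{y-x}$. *)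

(* Defs.v *)
From HB Require Import structures.
From mathcomp Require Import all_boot all_order all_algebra.
From mathcomp Require Import all_classical all_reals all_analysis.
Set Implicit Arguments. Unset Strict Implicit. Unset Printing Implicit Defensive.
Import Order.TTheory GRing.Theory Num.Theory.
Import numFieldNormedType.Exports.
Local Open Scope classical_set_scope.
Local Open Scope ring_scope.

(* A Cantor set, as a whole metric space X: nonempty, compact, (metric =
   Hausdorff pseudometric), totally disconnected, no isolated points. *)
Definition is_cantor_space {R : realType} (X : pseudoMetricType R) : Prop :=
  [/\ hausdorff_space X, [set: X] !=set0, compact [set: X],
      totally_disconnected [set: X] & forall x : X, ~ isolated [set: X] x].

Definition is_cantor_subset {R : realType} (K : set R) : Prop :=
  [/\ K !=set0, compact K, totally_disconnected K &
      forall x : R, ~ isolated K x].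

Definition homeo {T : topologicalType} (f : T -> T) : Prop :=
  continuous f /\
  exists g : T -> T, [/\ continuous g, cancel f g & cancel g f].

Definition homeo_on {R : realType} (K : set R) (f : R -> R) : Prop :=
  [/\ f @` K = K, {in K &, injective f} & {within K, continuous f}] /\
  exists g : R -> R,
    [/\ g @` K = K, {within K, continuous g},
        {in K, cancel f g} & {in K, cancel g f}].

Definition transitive_map {T : topologicalType} (f : T -> T) : Prop :=
  forall U V : set T, open U -> open V -> U !=set0 -> V !=set0 ->
    exists n : nat, (0 < n)%N /\ (iter n f @` U) `&` V !=set0.

Definition minimal_map {T : topologicalType} (f : T -> T) : Prop :=
  ~ exists A : set T, [/\ closed A, A !=set0, A <> setT & f @` A = A].

Definition periodic_point {T : Type} (f : T -> T) (x : T) : Prop :=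
  exists n : nat, (1 <= n)%N /\ iter n f x = x.

Definition conjugate_to {R : realType} {X : pseudoMetricType R}
    (T : X -> X) (K : set R) (f : R -> R) : Prop :=
  exists h : X -> R,
    [/\ continuous h, h @` [set: X] = K,
        (exists g : R -> X, {within K, continuous g} /\
            (cancel h g /\ {in K, cancel g h})) &
        forall x, h (T x) = f (h x)].

Definition zero_deriv_on {R : realType} (K : set R) (f : R -> R) : Prop :=
  forall x, K x ->
    (fun y => (f y - f x) / (y - x)) @ within (K `\ x) (nbhs x) --> (0 : R).

(* Main.v *)
(* The system is the product of the binary odometer and the full two-sided shift
   on two symbols. It has no periodic point because the odometer has none, it is
   transitive because the shift is mixing, and the points whose word is constant
   zero form a proper closed invariant subset.

   For each n, the points are divided into classes by their residue mod 2^n and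
   by a window of their word. If the classes of x and y separate at level n,
   their images in the real line are placed at a distance comparable to a weight
   of index 2^n + j, where j < 2^n is the position of the residue in the n-th
   odometer tower. Applying the map increases j by one, and since the weights
   decrease fast enough the distance is multiplied by a factor tending to 0. This
   fails only at the top of the tower. If all the towers started at residue 0 the
   point -1 would be at the top for every n; the n-th tower is therefore cut
   after the residue 2^(n-1), so that each point is at the top for at most one n,
   and the derivative vanishes everywhere. *)
Require Import Defs.
From HB Require Import structures.
From mathcomp Require Import all_boot all_order all_algebra.
From mathcomp Require Import all_classical all_reals all_analysis.
From mathcomp Require Import zify ring lra.
Set Implicit Arguments. Unset Strict Implicit. Unset Printing Implicit Defensive.
Import Order.TTheory GRing.Theory Num.Theory.
Import numFieldNormedType.Exports.
Local Open Scope classical_set_scope.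
Local Open Scope ring_scope.

(** * Real numbers from rapidly decreasing digit expansions *)

Section DigitExpansion.
Context (R : realType) (X : Type) (M : nat -> nat).
Context (c k : nat -> X -> nat).
Hypothesis c_le : forall n x, (c n x <= M (k n x))%N.
Hypothesis k_lt : forall n x, (k n x < k n.+1 x)%N.

(* Each weight dominates twice the tail of an expansion after it, and
   [digit_bound i.+1 / weight i] tends to [0]. *)
Fixpoint weight (i : nat) : R :=
  if i is i'.+1 then weight i' / (4 * i'.+1%:R * (M i'.+1).+1%:R) else 1.

Definition digit_bound (i : nat) : R := (M i).+1%:R * weight i.

Lemma weight_gt0 i : 0 < weight i.
Proof. by elim: i => [|i IH] /=; rewrite ?ltr01// divr_gt0// !mulr_gt0. Qed.

Lemma digit_bound_gt0 i : 0 < digit_bound i.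
Proof. by rewrite mulr_gt0 ?weight_gt0. Qed.

Lemma weight_le_digit_bound i : weight i <= digit_bound i.
Proof. by rewrite ler_peMl ?ler1n// ltW ?weight_gt0. Qed.

Lemma digit_boundS i : 4 * i.+1%:R * digit_bound i.+1 = weight i.
Proof.
rewrite /digit_bound /=; field.
by rewrite !nat1r !pnatr_eq0.
Qed.

Lemma digit_boundS_le i : 4 * digit_bound i.+1 <= weight i.
Proof.
by rewrite -digit_boundS ler_pM2r ?digit_bound_gt0// ler_peMr// ler1n.
Qed.

Lemma weight_le i j : (i <= j)%N -> weight j <= weight i.
Proof.
move=> /subnK <-; elim: (j - i)%N => // d IH; rewrite addSn.
apply: le_trans IH; apply: le_trans (digit_boundS_le _).
have := weight_le_digit_bound (d + i).+1.
have := digit_bound_gt0 (d + i).+1; lra.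
Qed.

Lemma digit_bound_lt_weight i j : (i < j)%N -> 4 * digit_bound j <= weight i.
Proof.
case: j => // j; rewrite ltnS => ij.
exact: le_trans (digit_boundS_le j) (weight_le ij).
Qed.

Definition expansion_upto (x : X) (n : nat) : R :=
  \sum_(i < n) (c i x)%:R * weight (k i x).

(** The partial sums increase, so this supremum is the sum of the series, and uniform bounds on the
    partial sums pass to it directly. *)
Definition expansion (x : X) : R := sup (range (expansion_upto x)).

(** The term at [k n x] costs at most one [digit_bound]; twice the bound at the next position is at
    most half a weight, hence at most half a [digit_bound]. *)
Lemma expansion_upto_tail x n d :
  expansion_upto x (n + d) <= expansion_upto x n + 2 * digit_bound (k n x).
Proof.
elim: d n => [|d IH] n.
  by rewrite addn0 lerDl mulr_ge0// ltW ?digit_bound_gt0.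
rewrite addnS -addSn; apply: (le_trans (IH _)).
rewrite {1}/expansion_upto big_ord_recr/= -/(expansion_upto x n) -addrA lerD2l.
have := digit_bound_lt_weight (k_lt n x).
have := weight_le_digit_bound (k n x); have := digit_bound_gt0 (k n x).
suff : (c n x)%:R * weight (k n x) <= digit_bound (k n x) by lra.
by rewrite ler_pM2r ?weight_gt0// ler_nat leqW.
Qed.

Lemma expansion_upto_mono x n d : expansion_upto x n <= expansion_upto x (n + d).
Proof.
elim: d => [|d]; first by rewrite addn0.
move=> /le_trans; apply; rewrite addnS [leRHS]big_ord_recr /= lerDl.
by rewrite mulr_ge0// ltW ?weight_gt0.
Qed.

Lemma expansion_upto_ub x n :
  ubound (range (expansion_upto x)) (expansion_upto x n + 2 * digit_bound (k n x)).
Proof.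
move=> _ [m _ <-]; have [/subnKC <-|/ltnW /subnKC {1}<-] := leqP n m.
  exact: expansion_upto_tail.
apply: (le_trans (expansion_upto_mono x m (n - m))).
by rewrite lerDl mulr_ge0// ltW ?digit_bound_gt0.
Qed.

Lemma expansion_ge x n : expansion_upto x n <= expansion x.
Proof.
apply: ub_le_sup; last by exists n.
by exists (expansion_upto x 0 + 2 * digit_bound (k 0 x)); exact: expansion_upto_ub.
Qed.

Lemma expansion_le x n :
  expansion x <= expansion_upto x n + 2 * digit_bound (k n x).
Proof.
by apply: ge_sup; [exists (expansion_upto x 0); exists 0%N|exact: expansion_upto_ub].
Qed.

(** Positions are compared up to [n] inclusive, so that the [n]-th digits, which may differ, carry
    the same weight. *)
Definition same_digits (n : nat) (x y : X) : Prop :=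
  (forall i, (i < n)%N -> c i x = c i y) /\
  (forall i, (i <= n)%N -> k i x = k i y).

Lemma same_digits_expansion_upto n x y : same_digits n x y ->
  expansion_upto x n = expansion_upto y n.
Proof.
by move=> [ec ek]; apply: eq_bigr => i _; rewrite ec// ek// ltnW.
Qed.

Lemma expansion_dist_le n x y : same_digits n x y ->
  `|expansion x - expansion y| <= 2 * digit_bound (k n x).
Proof.
move=> xy; have := expansion_ge x n; have := expansion_le x n.
have := expansion_ge y n; have := expansion_le y n.
rewrite -(same_digits_expansion_upto xy) -(xy.2 _ (leqnn n)) => *.
by rewrite ler_norml; apply/andP; split; lra.
Qed.

(** Differing digits contribute at least one weight, and the tail can cancel at most half of it. *)
Lemma expansion_dist_ge n x y : same_digits n x y -> c n x <> c n y ->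
  weight (k n x) / 2 <= `|expansion x - expansion y|.
Proof.
wlog : x y / (c n x < c n y)%N.
  move=> wl xy /eqP; rewrite neq_ltn => /orP[] cxy.
    by apply: wl => // e; rewrite e ltnn in cxy.
  rewrite distrC (xy.2 _ (leqnn n)); apply: wl => //.
    by split => i ni; [rewrite (xy.1 i ni)|rewrite (xy.2 i ni)].
  by move=> e; rewrite e ltnn in cxy.
move=> cxy xy _; rewrite distrC; apply: le_trans (ler_norm _).
have := expansion_le x n.+1; have := expansion_ge y n.+1.
rewrite /expansion_upto !big_ord_recr /= -!/(expansion_upto _ _).
rewrite -(same_digits_expansion_upto xy) -(xy.2 _ (leqnn n)).
have := digit_bound_lt_weight (k_lt n x).
suff : (c n x)%:R * weight (k n x) + weight (k n x)
    <= (c n y)%:R * weight (k n x) by lra.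
by rewrite -[X in _ + X]mul1r -mulrDl natr1 ler_pM2r ?weight_gt0// ler_nat.
Qed.

End DigitExpansion.

(** * The odometer times the shift *)

(* The coordinates [inl n] are the binary digits of a 2-adic integer, the
   coordinates [inr z] form a bi-infinite binary word. *)
Definition cantor_system : Type := prod_topology (fun _ : nat + int => bool).

HB.instance Definition _ := Choice.on cantor_system.
HB.instance Definition _ := Nbhs.on cantor_system.
HB.instance Definition _ := Topological.on cantor_system.
HB.instance Definition _ := Uniform.on cantor_system.
HB.instance Definition _ (R : realType) := PseudoMetric.copy cantor_system
  (prod_topology (fun _ : (nat + int)%type => bool : pseudoMetricType R)).

Fixpoint residue (n : nat) (x : cantor_system) : nat :=
  if n is m.+1 then (residue m x + x (inl m) * 2 ^ m)%N else 0%N.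

Fixpoint carry (n : nat) (x : cantor_system) : bool :=
  if n is m.+1 then x (inl m) && carry m x else true.

Fixpoint borrow (n : nat) (x : cantor_system) : bool :=
  if n is m.+1 then ~~ x (inl m) && borrow m x else true.

Definition step (x : cantor_system) : cantor_system := fun i =>
  match i with
  | inl n => x (inl n) (+) carry n x
  | inr z => x (inr (z + 1))
  end.

Definition unstep (x : cantor_system) : cantor_system := fun i =>
  match i with
  | inl n => x (inl n) (+) borrow n x
  | inr z => x (inr (z - 1))
  end.

Lemma carry_unstep n x : carry n (unstep x) = borrow n x.
Proof. by elim: n => //= n ->; case: (x _); case: (borrow _ _). Qed.

Lemma borrow_step n x : borrow n (step x) = carry n x.
Proof. by elim: n => //= n ->; case: (x _); case: (carry _ _). Qed.

Lemma stepK : cancel step unstep.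
Proof.
move=> x; apply/funext => -[n|z] /=; last by rewrite subrK.
by rewrite borrow_step addbK.
Qed.

Lemma unstepK : cancel unstep step.
Proof.
move=> x; apply/funext => -[n|z] /=; last by rewrite addrK.
by rewrite carry_unstep addbK.
Qed.

Lemma residue_lt n x : (residue n x < 2 ^ n)%N.
Proof. by elim: n => //= n IH; rewrite expnS; case: (x _); lia. Qed.

(** Keeping the overflow as a carry bit, instead of reducing, makes the induction linear
    arithmetic. *)
Lemma residue_step_carry n x :
  (residue n (step x) + carry n x * 2 ^ n = residue n x + 1)%N.
Proof.
elim: n => //= n; rewrite expnS; case: (x _); case: (carry _ _) => /=; lia.
Qed.

Lemma residue_step n x : residue n (step x) = ((residue n x).+1 %% 2 ^ n)%N.
Proof.
by rewrite -addn1 -residue_step_carry addnC modnMDl modn_small ?residue_lt.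
Qed.

Lemma residue_iter n t x :
  residue n (iter t step x) = ((residue n x + t) %% 2 ^ n)%N.
Proof.
elim: t => [|t IH]; first by rewrite addn0 modn_small ?residue_lt.
by rewrite iterS residue_step IH -addn1 modnDml addn1 addnS.
Qed.

Lemma iter_step_inr t x z : iter t step x (inr z) = x (inr (z + t%:Z)).
Proof.
elim: t z => [|t IH] z; first by rewrite addr0.
by rewrite iterS /= IH -addrA; congr (x (inr (_ + _))); lia.
Qed.

Lemma residue_mod m n x : (m <= n)%N ->
  residue m x = (residue n x %% 2 ^ m)%N.
Proof.
move=> /subnK <-; elim: (n - m)%N => [|d IH]; first by rewrite modn_small ?residue_lt.
by rewrite addSn /= IH expnD mulnA [in RHS]addnC modnMDl.
Qed.

Lemma residue_inj x y : (forall n, residue n x = residue n y) ->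
  forall n, x (inl n) = y (inl n).
Proof.
move=> xy n; have := xy n.+1; rewrite /= xy => /addnI /eqP.
by rewrite eqn_mul2r expn_eq0 /=; case: (x _); case: (y _).
Qed.

(* Residue [2 ^ n.-1] gets the largest height [2 ^ n - 1]. *)
Definition height (n : nat) (x : cantor_system) : nat :=
  ((residue n x + 2 ^ n.-1 - 1) %% 2 ^ n)%N.

Lemma height_lt n x : (height n x < 2 ^ n)%N.
Proof. by rewrite ltn_mod expn_gt0. Qed.

Lemma height_step n x : (0 < n)%N -> residue n x <> (2 ^ n.-1)%N ->
  height n (step x) = (height n x).+1.
Proof.
rewrite /height residue_step.
have := residue_lt n x; move: (residue n x) => r; case: n => // n rN _ /=.
have n0 : (0 < 2 ^ n)%N by rewrite expn_gt0.
rewrite expnS in rN *; move: (2 ^ n)%N n0 rN => N N0 r2 rN.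
(* With [N] half the modulus, the height wraps after [r = N], which is excluded; the residue wraps
   after [r = 2 * N - 1], treated apart. *)
have [rl|rl] := ltnP r N.
  by rewrite (@modn_small r.+1) ?modn_small; lia.
have -> : (r + N - 1 = (r - N - 1) + 2 * N)%N by lia.
rewrite modnDr (modn_small (_ : r - N - 1 < _)%N); last lia.
have [rE|rl'] : (r.+1 = 2 * N \/ r.+1 < 2 * N)%N by lia.
  by rewrite rE modnn add0n modn_small; lia.
rewrite (modn_small rl').
have -> : (r.+1 + N - 1 = r - N + 2 * N)%N by lia.
by rewrite modnDr modn_small; lia.
Qed.

(** If [residue n x] is [2 ^ n.-1], all lower residues vanish. So one nonzero residue rules this out
    at every higher level, and if all residues vanish it never happens. *)
Lemma residue_neq_eventually x :
  exists n0, forall n, (n0 <= n)%N -> residue n x <> (2 ^ n.-1)%N.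
Proof.
have [[n0 rn0]|all0] := pselect (exists n, residue n x <> 0%N); last first.
  exists 0%N => n _ rn; apply: all0; exists n; rewrite rn => /eqP.
  by rewrite expn_eq0.
exists n0.+1 => -[//|n]; rewrite ltnS => n0n /=.
have := residue_lt n x.
have : residue n x <> 0%N.
  by move=> rn; apply: rn0; rewrite (residue_mod x n0n) rn mod0n.
by case: (x _); lia.
Qed.

(* The window of the word is attached to the tower of height [2 ^ n], not to the
   point: it moves along with the shift, so that [step] preserves [agree n]
   except at the top of the tower. *)
Definition agree (n : nat) (x y : cantor_system) : Prop :=
  residue n x = residue n y /\
  forall z : int, - (height n x)%:Z - (2 ^ n)%:Z <= z ->
    z < (2 ^ n.+1)%:Z - (height n x)%:Z -> x (inr z) = y (inr z).

Lemma agree_residue n x y i : agree n x y -> (i <= n)%N ->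
  residue i x = residue i y.
Proof. by move=> [xy _] ni; rewrite !(residue_mod _ ni) xy. Qed.

Lemma agree_height n x y i : agree n x y -> (i <= n)%N ->
  height i x = height i y.
Proof. by move=> xy ni; rewrite /height (agree_residue xy ni). Qed.

(** Heights are below [2 ^ m] and [2 ^ n], so the window of level [m] stays within
    [2 ^ m.+1 <= 2 ^ n] of the origin, a range that the window of level [n] always covers. *)
Lemma agree_le m n x y : (m <= n)%N -> agree n x y -> agree m x y.
Proof.
move=> mn xy; split; first exact: agree_residue xy mn.
move=> z; have [->|mn'] := eqVneq m n; first exact: xy.2.
move=> z1 z2; have lmn : (2 ^ m.+1 <= 2 ^ n)%N by rewrite leq_exp2l// ltn_neqAle mn'.
have hm := height_lt m x; have hn := height_lt n x.
by apply: xy.2; move: z1 z2 lmn; rewrite !expnS; lia.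
Qed.

Lemma agree_step n x y : (0 < n)%N -> residue n x <> (2 ^ n.-1)%N ->
  agree n x y -> agree n (step x) (step y).
Proof.
move=> n0 rx [xy1 xy2]; split; first by rewrite !residue_step xy1.
by rewrite height_step// => z z1 z2 /=; apply: xy2; lia.
Qed.

Lemma agree_eq x y : (forall n, agree n x y) -> x = y.
Proof.
move=> xy; apply/funext => -[n|z].
  by apply: residue_inj => m; exact: (xy m).1.
apply: (xy `|z|%N).2; have := height_lt `|z|%N x; have := ltn_expl `|z| (ltnSn 1);
  rewrite ?expnS; lia.
Qed.

Lemma agree_box n x y : (forall i, (i < n)%N -> x (inl i) = y (inl i)) ->
  (forall z : int, - (2 ^ n.+1)%:Z <= z -> z < (2 ^ n.+1)%:Z ->
    x (inr z) = y (inr z)) -> agree n x y.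
Proof.
move=> xy1 xy2; split.
  by elim: n xy1 {xy2} => //= n IH xy; rewrite xy// IH// => i /leqW; exact: xy.
by move=> z z1 z2; apply: xy2; have := height_lt n x; move: z1 z2; rewrite !expnS; lia.
Qed.

(* The window of [agree n] has length [2 ^ n.+1 + 2 ^ n]. *)
Definition pattern (n : nat) : finType :=
  ('I_(2 ^ n) * {ffun 'I_(3 * 2 ^ n) -> bool})%type.

Definition pattern_of (n : nat) (x : cantor_system) : pattern n :=
  (Ordinal (residue_lt n x),
   [ffun i : 'I_(3 * 2 ^ n) => x (inr (i%:Z - (height n x)%:Z - (2 ^ n)%:Z))]).

Lemma pattern_ofP n x y : pattern_of n x = pattern_of n y <-> agree n x y.
Proof.
split=> [[rxy /ffunP wxy]|xy].
  split=> // z z1 z2; have hxy : height n x = height n y by rewrite /height rxy.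
  have [i zE] : exists i : nat, z = i%:Z - (height n x)%:Z - (2 ^ n)%:Z.
    by exists (absz (z + (height n x)%:Z + (2 ^ n)%:Z)); lia.
  have iP : (i < 3 * 2 ^ n)%N by move: z1 z2; rewrite zE expnS; lia.
  by have := wxy (Ordinal iP); rewrite !ffunE -hxy /= -zE.
congr pair; first by apply: val_inj; exact: xy.1.
apply/ffunP => i; rewrite !ffunE -(agree_height xy)//.
by apply: xy.2; have := ltn_ord i; rewrite ?expnS; lia.
Qed.

(** Digit [n] records level [n.+1]: when it is the first to differ, the points still agree at level
    [n > 0] and share the position of that digit. *)
Definition digit (n : nat) (x : cantor_system) : nat :=
  enum_rank (pattern_of n.+1 x).

Lemma digitP n x y : digit n x = digit n y <-> agree n.+1 x y.
Proof.
rewrite -pattern_ofP; split=> [/val_inj /enum_rank_inj //|xy].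
by rewrite /digit xy.
Qed.

Definition position (n : nat) (x : cantor_system) : nat := (2 ^ n + height n x)%N.

(** Positions of level [n] lie in [[2 ^ n, 2 ^ n.+1)], so the logarithm recovers the level and the
    bound depends on the position alone, as the weights require. *)
Definition digit_max (i : nat) : nat := #|pattern (trunc_log 2 i).+1|.

Lemma digit_le n x : (digit n x <= digit_max (position n x))%N.
Proof.
rewrite /digit_max /position (@trunc_log_eq 2 n)//.
  exact/ltnW/ltn_ord.
by rewrite leq_addr/= expnS mul2n -addnn ltn_add2l height_lt.
Qed.

Lemma position_lt n x : (position n x < 2 ^ n.+1)%N.
Proof. by have := height_lt n x; rewrite /position expnS; lia. Qed.

Lemma position_ltS n x : (position n x < position n.+1 x)%N.
Proof. exact: leq_trans (position_lt n x) (leq_addr _ _). Qed.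

Lemma agree_same_digits n x y : agree n x y -> same_digits digit position n x y.
Proof.
move=> xy; split => i ni; first exact/digitP/(agree_le _ xy).
by rewrite /position (agree_height xy).
Qed.

Lemma first_split x y : x <> y -> exists n,
  [/\ same_digits digit position n x y, (0 < n)%N -> agree n x y &
      digit n x <> digit n y].
Proof.
move=> xy; have /ex_minnP[n /eqP nxy nmin] : exists n, digit n x != digit n y.
  apply: contrapT => /forallNP eqd; apply: xy; apply: agree_eq => n.
  apply: (agree_le (leqnSn n)); apply/digitP/eqP.
  exact/negPn/negP/eqd.
exists n; suff an : (0 < n)%N -> agree n x y.
  split=> //; case: n {nxy nmin} an => [_|n /(_ isT)]; last exact: agree_same_digits.
  (* At level 0 the modulus is 1, so all points share the position even if [agree 0] fails. *)
  by split=> // -[|i]//; rewrite /position /height /= modn1.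
case: n nxy nmin => // n _ nmin _; apply/digitP/eqP/negPn/negP => /nmin.
by rewrite ltnn.
Qed.

(** * Absence of periodic points, and mixing *)

Lemma step_aperiodic x : ~ periodic_point step x.
Proof.
(* Modulo [2 ^ t], adding [t] moves every residue, since [0 < t < 2 ^ t]. *)
move=> [t [t0 tx]]; have := residue_iter t t x; rewrite tx.
have := ltn_expl t (ltnSn 1); have := residue_lt t x.
move: (residue t x) (2 ^ t)%N => r N rN tN.
have [rt|rt] := ltnP (r + t) N; first by rewrite modn_small//; lia.
have -> : (r + t = r + t - N + N)%N by lia.
by rewrite modnDr modn_small; lia.
Qed.

Lemma step_mixes_agree n x y : exists t w,
  [/\ (0 < t)%N, agree n w x & agree n (iter t step w) y].
Proof.
pose B := (2 ^ n.+1)%N; have B0 : (0 < B)%N by rewrite expn_gt0.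
(* Modulo [2 ^ n] this is the difference of the residues; the four extra periods make the windows at
   times 0 and [t] disjoint. *)
pose t := (residue n y + 2 ^ n - residue n x + 2 ^ n * 4)%N.
have tB : (B + B <= t)%N by have := residue_lt n x; rewrite /t /B expnS; lia.
(* The word of [x] on the left is glued to the word of [y], delayed by [t], on the right. *)
pose w : cantor_system := fun i => match i with
  | inl _ => x i
  | inr z => if z < B%:Z then x i else y (inr (z - t%:Z)) end.
exists t, w; split; first lia.
  by apply: agree_box => // z _ zB; rewrite /= zB.
have rw : residue n w = residue n x by elim: (n) => //= m ->.
split.
  rewrite residue_iter rw.
  have -> : (residue n x + t = 5 * 2 ^ n + residue n y)%N.
    by rewrite /t; have := residue_lt n x; lia.
  by rewrite modnMDl modn_small ?residue_lt.
move=> z z1 z2; rewrite iter_step_inr /= ifF ?addrK//.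
apply/negbTE; rewrite -leNgt; have := height_lt n (iter t step w).
by move: z1 z2 tB; rewrite /B expnS; lia.
Qed.

(** * Topology and the embedding into the reals *)

Lemma near_coord (x : cantor_system) i : \forall y \near x, y i = x i.
Proof.
have := @proj_continuous _ (fun _ : nat + int => bool) i x [set x i].
apply; exact: (@discrete_set1 bool).
Qed.

Lemma locally_constant_coords_continuous (f : cantor_system -> cantor_system) :
  (forall i x, \forall y \near x, f y i = f x i) -> continuous f.
Proof.
move=> fP x; apply/cvg_sup => i U [V] [[W] oW <-] Wfx WU.
apply: (filterS WU); rewrite nbhs_simpl /=.
by apply: filterS (fP i x) => y fyx; rewrite /preimage/= fyx.
Qed.

Lemma near_carry n (x : cantor_system) : \forall y \near x, carry n y = carry n x.
Proof.
elim: n => [|n IH] /=; first by apply: filterE.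
by apply: filterS2 (near_coord x (inl n)) IH => y -> ->.
Qed.

Lemma near_borrow n (x : cantor_system) : \forall y \near x, borrow n y = borrow n x.
Proof.
elim: n => [|n IH] /=; first by apply: filterE.
by apply: filterS2 (near_coord x (inl n)) IH => y -> ->.
Qed.

Lemma step_continuous : continuous step.
Proof.
apply: locally_constant_coords_continuous => -[n|z] x /=; last exact: near_coord.
by apply: filterS2 (near_coord x (inl n)) (near_carry n x) => y -> ->.
Qed.

Lemma unstep_continuous : continuous unstep.
Proof.
apply: locally_constant_coords_continuous => -[n|z] x /=; last exact: near_coord.
by apply: filterS2 (near_coord x (inl n)) (near_borrow n x) => y -> ->.
Qed.

Lemma near_agree n (x : cantor_system) : \forall y \near x, agree n y x.
Proof.
have nearI (N : nat) (ix : nat -> nat + int) :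
    \forall y \near x, forall m, (m < N)%N -> y (ix m) = x (ix m).
  elim: N => [|N IH]; first by apply: filterE.
  apply: filterS2 (near_coord x (ix N)) IH => y yN yIH m.
  by rewrite ltnS leq_eqVlt => /predU1P[->//|]; exact: yIH.
apply: filterS2 (nearI n inl)
  (nearI (2 ^ n.+2)%N (fun m => inr (m%:Z - (2 ^ n.+1)%:Z))) => y yl yr.
apply: agree_box => // z z1 z2.
have [m zE] : exists m : nat, z = m%:Z - (2 ^ n.+1)%:Z.
  by exists (absz (z + (2 ^ n.+1)%:Z)); lia.
by rewrite zE; apply: yr; move: z1 z2; rewrite zE (expnS _ n.+1); lia.
Qed.

Lemma cantor_system_compact : compact [set: cantor_system].
Proof.
have := @tychonoff _ (fun _ : nat + int => bool) _ (fun=> bool_compact).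
by congr (compact _); rewrite eqEsubset.
Qed.

Lemma cantor_system_hausdorff : hausdorff_space cantor_system.
Proof. by apply: hausdorff_product => ?; exact: discrete_hausdorff. Qed.

Lemma cantor_system_totally_disconnected :
  totally_disconnected [set: cantor_system].
Proof.
apply: zero_dimension_totally_disconnected.
by apply: zero_dimension_prod => _; exact: discrete_zero_dimension.
Qed.

Section Embedding.
Context (R : realType).

Definition embed : cantor_system -> R := expansion R digit_max digit position.

(** The factor [i.+1] in the recursion for [weight] makes [digit_bound] at [i.+1] at most
    [1 / i.+1]. *)
Lemma digit_bound_lt_eventually (e : R) : 0 < e ->
  exists N, forall i, (N <= i)%N -> digit_bound R digit_max i < e.
Proof.
move=> e0; have [N _ NP] := near_infty_natSinv_lt (PosNum e0).
exists N.+1 => -[//|i]; rewrite ltnS => Ni; apply: le_lt_trans (NP i Ni).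
rewrite -[leRHS]mul1r ler_pdivlMr// mulrC.
have := digit_boundS R digit_max i; have := weight_le R digit_max (leq0n i).
rewrite -mulrA [weight _ _ 0]/= => + e4.
have := mulr_gt0 (ltr0Sn R i) (digit_bound_gt0 R digit_max i.+1); lra.
Qed.

Lemma embed_agree (e : R) : 0 < e ->
  exists n, forall x y, agree n x y -> `|embed x - embed y| < e.
Proof.
move=> e0; have [N NP] := digit_bound_lt_eventually (divr_gt0 e0 (ltr0Sn R 1)).
exists N => x y /agree_same_digits xy.
apply: le_lt_trans (expansion_dist_le R digit_le position_ltS xy) _.
rewrite mulrC -ltr_pdivlMr//; apply: NP.
by rewrite (leq_trans (ltnW (ltn_expl N (ltnSn 1))))// leq_addr.
Qed.

Lemma embed_inj : injective embed.
Proof.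
move=> x y exy; apply: contrapT => /first_split[n [xy _ nxy]].
have := expansion_dist_ge R digit_le position_ltS xy nxy.
rewrite -/embed exy subrr normr0 leNgt divr_gt0 ?weight_gt0//.
Qed.

Lemma embed_continuous : continuous embed.
Proof.
move=> x; apply/cvgrPdist_lt => e /embed_agree[n nP].
by apply: filterS (near_agree n x) => y /nP; rewrite distrC.
Qed.

Definition unembed (y : R) : cantor_system :=
  xget (fun=> false) [set x | embed x = y].

Lemma embedK : cancel embed unembed.
Proof.
move=> x; apply: embed_inj.
by have /(xgetPex (fun=> false)) : exists z, [set x' | embed x' = embed x] z by exists x.
Qed.

Lemma unembedK : {in range embed, cancel unembed embed}.
Proof. by move=> y; rewrite inE => -[x _ <-]; rewrite embedK. Qed.

Lemma embed_compact (A : set cantor_system) : closed A -> compact (embed @` A).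
Proof.
move=> cA; apply: continuous_compact.
  exact/continuous_subspaceT/embed_continuous.
exact: subclosed_compact cA cantor_system_compact _.
Qed.

(** By compactness: within the range, the preimage of a closed set is its image under [embed], which
    is compact and so closed. *)
Lemma unembed_continuous : {within range embed, continuous unembed}.
Proof.
apply/continuous_closedP => A cA; apply/closed_subspaceP.
exists (embed @` A).
  by apply: compact_closed (embed_compact cA); exact: Rhausdorff.
rewrite eqEsubset; split => y [].
  move=> [x Ax <-] _; split; last by exists x.
  by rewrite /preimage /from_subspace/= embedK.
rewrite /preimage /from_subspace/= => + [x _ xy].
by rewrite -xy embedK => Ax; split; exists x.
Qed.

(** Continuity of [unembed] yields a real ball around [embed x], and agreement at a high level keeps
    [embed y] in it. *)
Lemma nbhs_agree (x : cantor_system) U : nbhs x U ->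
  exists n, forall y, agree n x y -> U y.
Proof.
move=> xU; have /subspace_continuousP/(_ (embed x)) := unembed_continuous.
rewrite /from_subspace embedK => /(_ (imageT _ _))/(_ U xU).
rewrite nbhs_simpl /= => /nbhs_ballP[e e0 eU].
have [n nP] := embed_agree e0; exists n => y /nP xy.
by rewrite -(embedK y); apply: eU; [exact: xy|exists y].
Qed.

End Embedding.
(** * The conjugate map with zero derivative *)

Lemma nonisolated (R : realType) (x : cantor_system) : ~ isolated [set: cantor_system] x.
Proof.
move=> [_ [V Vx]]; rewrite setIT => VE.
have [n nV] := nbhs_agree R Vx.
(* Flipping digit [n] changes neither the residue modulo [2 ^ n] nor the word. *)
pose y : cantor_system := fun i => if i is inl m then x i (+) (m == n) else x i.
have : y = x.
  suff : V y by rewrite VE.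
  apply: nV; apply: agree_box => // i ni /=.
  by rewrite (ltn_eqF ni) addbF.
by move=> /(congr1 (@^~ (inl n))) /=; rewrite eqxx addbT; case: (x _).
Qed.

Lemma cantor_system_is_cantor (R : realType) :
  @is_cantor_space R cantor_system.
Proof.
split.
- exact: cantor_system_hausdorff.
- by exists (fun=> false).
- exact: cantor_system_compact.
- exact: cantor_system_totally_disconnected.
- exact: (@nonisolated R).
Qed.

(** * Dynamical properties of the system *)

Lemma step_homeo : homeo step.
Proof.
split; first exact: step_continuous.
by exists unstep; split; [exact: unstep_continuous|exact: stepK|exact: unstepK].
Qed.

Lemma step_transitive (R : realType) : transitive_map step.
Proof.
move=> U V oU oV [x Ux] [y Vy].
have [n nU] := nbhs_agree R (open_nbhs_nbhs (conj oU Ux)).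
have [m mV] := nbhs_agree R (open_nbhs_nbhs (conj oV Vy)).
have [t [w [t0 wx wy]]] := step_mixes_agree (maxn n m) x y.
have agreeC i a b : agree i a b -> agree i b a.
  by move=> /pattern_ofP ab; apply/pattern_ofP.
exists t; split=> //; exists (iter t step w); split.
  exists w => //; apply: nU; apply/agreeC; exact: agree_le (leq_maxl _ _) wx.
apply: mV; apply/agreeC; exact: agree_le (leq_maxr _ _) wy.
Qed.

Lemma step_not_minimal : ~ minimal_map step.
Proof.
apply; exists [set x : cantor_system | forall z, x (inr z) = false]; split.
- rewrite -[X in closed X]setCK; apply: open_closedC; rewrite openE => x.
  move=> /existsNP[z xz]; apply: filterS (near_coord x (inr z)) => y yz /(_ z).
  by rewrite yz.
- by exists (fun=> false).
- by move=> /seteqP[_ /(_ (fun=> true) I) /(_ 0)].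
- rewrite eqEsubset; split => [_ [x x0 <-] z|x x0]; first exact: x0.
  by exists (unstep x); [move=> z; exact: x0|exact: unstepK].
Qed.

(** * Transport to the real line and the derivative *)

Section ConjugateMap.
Context (R : realType).
Local Notation embed := (@embed R).
Local Notation unembed := (@unembed R).

Lemma range_embed_cantor : is_cantor_subset (range embed).
Proof.
split.
- by exists (embed (fun=> false)); exists (fun=> false).
- exact: embed_compact closedT.
- move=> y Ky; rewrite eqEsubset; split; last first.
    by move=> _ ->; exact: connected_component_refl.
  move=> z [C [Cy CK Cconn] Cz].
  have gC : connected (unembed @` C).
    apply: connected_continuous_connected => //.
    exact: continuous_subspaceW CK (@unembed_continuous R).
  have := cantor_system_totally_disconnected (x := unembed y) I.
  move=> /seteqP[+ _] => /(_ (unembed z)) gzy.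
  have : unembed z = unembed y.
    by apply: gzy; exists (unembed @` C); [split=> //; exists y|exists z].
  by move=> /(congr1 embed); rewrite !unembedK// inE; exact: CK.
- move=> y [/set_mem[x _ <-] [V Vx VE]].
  apply: (@nonisolated R x); split; first exact: in_setT.
  exists (embed @^-1` V); first exact: embed_continuous.
  rewrite setIT eqEsubset; split=> [z Vz|_ ->]; last exact: (nbhs_singleton Vx).
  apply: (@embed_inj R); suff : (V `&` range embed) (embed z) by rewrite VE.
  by split=> //; exists z.
Qed.

Definition transport (g : cantor_system -> cantor_system) : R -> R :=
  embed \o g \o unembed.

Lemma transport_embed g x : transport g (embed x) = embed (g x).
Proof. by rewrite /transport /= embedK. Qed.

Lemma transport_continuous g : continuous g ->
  {within range embed, continuous (transport g)}.
Proof.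
move=> cg; rewrite /transport.
apply: within_continuous_comp (@unembed_continuous R) => x _.
by apply: continuous_comp; [exact: cg|exact: embed_continuous].
Qed.

Lemma transport_range g g' : cancel g' g -> transport g @` range embed = range embed.
Proof.
move=> gK; rewrite eqEsubset; split.
  by move=> _ [_ [x _ <-] <-]; rewrite transport_embed; exists (g x).
move=> _ [x _ <-]; exists (embed (g' x)); first by exists (g' x).
by rewrite transport_embed gK.
Qed.

Lemma transportK g g' : cancel g g' ->
  {in range embed, cancel (transport g) (transport g')}.
Proof. by move=> gK _ /set_mem[x _ <-]; rewrite !transport_embed gK. Qed.

Lemma transport_step_homeo : homeo_on (range embed) (transport step).
Proof.
split.
  split; [exact: transport_range unstepK| |].
    by move=> x y xK yK; exact: (can_in_inj (transportK stepK)).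
  exact: transport_continuous step_continuous.
exists (transport unstep); split.
- exact: transport_range stepK.
- exact: transport_continuous unstep_continuous.
- exact: transportK stepK.
- exact: transportK unstepK.
Qed.

Lemma step_conjugate : conjugate_to step (range embed) (transport step).
Proof.
exists embed; split=> //; first exact: embed_continuous.
  exists unembed; split; first exact: unembed_continuous.
  by split; [exact: embedK|exact: unembedK].
by move=> x; rewrite transport_embed.
Qed.

Lemma embed_step_contracts (x : cantor_system) (e : R) : 0 < e ->
  exists2 d, 0 < d & forall y, `|embed x - embed y| < d ->
    `|embed (step x) - embed (step y)| <= e * `|embed x - embed y|.
Proof.
move=> e0; have [n0 n0P] := residue_neq_eventually x.
have [N _ NP] := near_infty_natSinv_lt (PosNum e0).
(* Beyond [n0] the point is never at the top of a tower; beyond [N] the contraction factor is below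
   [e]. Up to level [n1] positions stay below [2 ^ n1.+1], so this [d] forces a later split. *)
pose n1 := maxn n0 N.
exists (weight R digit_max (2 ^ n1.+1) / 2); first by rewrite divr_gt0 ?weight_gt0.
move=> y xyd; have [->|/eqP/first_split[n [xy axy nxy]]] := eqVneq x y.
  by rewrite !subrr normr0 mulr0.
have lb := expansion_dist_ge R digit_le position_ltS xy nxy.
have n1n : (n1 < n)%N.
  rewrite ltnNge; apply/negP => nn1; have := lt_le_trans (lt_le_trans xyd _) lb.
  rewrite ltxx => /(_ _); apply/implyP.
  rewrite ler_pM2r ?invr_gt0//; apply: weight_le.
  by rewrite (leq_trans (ltnW (position_lt n x)))// leq_exp2l.
have n_gt0 : (0 < n)%N by exact: leq_ltn_trans n1n.
have rx : residue n x <> (2 ^ n.-1)%N.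
  by apply: n0P; apply: leq_trans (ltnW n1n); exact: leq_maxl.
(* With [k] the position of the split, the images are within [2 * digit_bound k.+1], while the
   points are at least [weight k / 2] apart, which is [k.+1] times as much. *)
have := expansion_dist_le R digit_le position_ltS
  (agree_same_digits (agree_step n_gt0 rx (axy n_gt0))).
move=> /le_trans; apply; apply: le_trans (ler_wpM2l (ltW e0) lb).
have -> : position n (step x) = (position n x).+1.
  by rewrite /position height_step// addnS.
set k := position n x; rewrite -(digit_boundS R digit_max k).
have ke : k.+1%:R^-1 < e.
  apply: (NP k); apply: leq_trans (leq_addr _ _).
  rewrite (leq_trans _ (ltnW (ltn_expl n (ltnSn 1))))// (leq_trans _ (ltnW n1n))//.
  exact: leq_maxr.
have : 1 <= e * k.+1%:R by rewrite -ler_pdivrMr// div1r ltW.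
have := digit_bound_gt0 R digit_max k.+1.
move: (digit_bound _ _ _) (k.+1%:R) => D K D0 eK; nra.
Qed.

Lemma transport_step_zero_deriv : zero_deriv_on (range embed) (transport step).
Proof.
move=> _ [x _ <-]; apply/cvgrPdist_lt => e e0.
(* Halving [e] turns the weak inequality into a strict one. *)
have [d d0 dP] := embed_step_contracts x (divr_gt0 e0 (ltr0Sn R 1)).
rewrite near_withinE; apply/nbhs_ballP; exists d => //= z + [[y _ yz]].
rewrite -{z}yz => /dP xyd yx.
rewrite !transport_embed sub0r normrN normrM normfV distrC [`|embed y - _|]distrC.
have xy0 : 0 < `|embed x - embed y|.
  by rewrite normr_gt0 subr_eq0 eq_sym; apply/eqP.
rewrite ltr_pdivrMr//; apply: le_lt_trans xyd _.
by rewrite ltr_pM2r// ltr_pdivrMr// ltr_pMr// ltr1n.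
Qed.

End ConjugateMap.

Theorem theoremC (R : realType) :
  exists (X : pseudoMetricType R) (T : X -> X),
    [/\ is_cantor_space X, homeo T, transitive_map T, ~ minimal_map T &
        forall x : X, ~ periodic_point T x] /\
    exists (K : set R) (f : R -> R),
      [/\ is_cantor_subset K, homeo_on K f, conjugate_to T K f &
          zero_deriv_on K f].
Proof.
exists cantor_system, step; split.
  split; [exact: cantor_system_is_cantor|exact: step_homeo|
    exact: step_transitive|exact: step_not_minimal|exact: step_aperiodic].
exists (range (@embed R)), (@transport R step); split.
- exact: range_embed_cantor.
- exact: transport_step_homeo.
- exact: step_conjugate.
- exact: transport_step_zero_deriv.
Qed.
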